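(* Consider the quantized estimation system below, under the assumption that all partitioned observation subvectors $\{\mathbf{x}_{jl}\}$ are known to be independent, with $\mathbf{x}_{jl}$ having statistical model $(\mathscr{X}_{jl},\mathscr{F}_{jl},\mathscr{P}_{jl}^{\boldsymbol{\theta}})$. (i) Suppose the interior of $\boldsymbol{\Theta}\subset\mathbb{R}^{D_{\boldsymbol{\theta}}}$ is nonempty and every $q_j^{(\mathbf{s})}(\boldsymbol{\theta})$ is twice differentiable in $\boldsymbol{\theta}$ on $\boldsymbol{\Theta}$. Then for any $\boldsymbol{\theta}$, any quantization regions $\{I_{jl}^{(r)}\}$ and any statistical models $\{(\mathscr{X}_{jl},\mathscr{F}_{jl},\mathscr{P}_{jl}^{\boldsymbol{\theta}})\}$, if $$D_{\boldsymbol{\theta}} > \lambda_{\text{Indep}}(N,\{R_{jl}\}) := \sum_{j=1}^N\sum_{l=1}^{L_j}R_{jl}-\sum_{j=1}^N L_j,$$ then the Fisher information matrix for estimating $\boldsymbol{\theta}$ is singular. (ii) Suppose the interior of $\boldsymbol{\Theta}$ is nonempty and every $q_j^{(\mathbf{s})}(\boldsymbol{\theta})$ is continuous in $\boldsymbol{\theta}$. Then for any $\{I_{jl}^{(r)}\}$ and any $\{(\mathscr{X}_{jl},\mathscr{F}_{jl},\mathscr{P}_{jl}^{\boldsymbol{\theta}})\}$, if the same inequality $D_{\boldsymbol{\theta}}>\lambda_{\text{Indep}}(N,\{R_{jl}\})$ holds, the vector parameter space $\boldsymbol{\Theta}$ is not identifiable; moreover, every open subset $\mathcal{U}\subset\boldsymbol{\Theta}$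 of $\mathbb{R}^{D_{\boldsymbol{\theta}}}$ contains infinitely many nonidentifiable vector parameter points.
   Context: System: $N$ sensors; sensor $j$ observes $\mathbf{x}_j$ with statistical model $(\mathscr{X}_j,\mathscr{F}_j,\mathscr{P}_j^{\boldsymbol{\theta}})$, independent across $j$, unknown $\boldsymbol{\theta}\in\boldsymbol{\Theta}\subset\mathbb{R}^{D_{\boldsymbol{\theta}}}$. $\mathbf{x}_j$ is partitioned into $L_j$ subvectors $\mathbf{x}_{jl}$, each quantized by an $R_{jl}$-level vector quantizer $\gamma_{jl}(\mathbf{x}_{jl})=\sum_r r\,\mathbb{1}\{\mathbf{x}_{jl}\in I_{jl}^{(r)}\}$ with disjoint covering regions; the superquantizer output $\mathbf{u}_j=\Gamma_j(\mathbf{x}_j)=[\gamma_{j1}(\mathbf{x}_{j1}),\dots,\gamma_{jL_j}(\mathbf{x}_{jL_j})]^T$ is sent error-free to a fusion center, which estimates $\boldsymbol{\theta}$ from $\mathbf{u}=[\mathbf{u}_1^T,\dots,\mathbf{u}_N^T]^T$. $q_j^{(\mathbf{s})}(\boldsymbol{\theta})=\mathscr{P}_j^{\boldsymbol{\theta}}(\Gamma_j(\mathbf{x}_j)=\mathbf{s})$; under independence of subvectors, $q_j^{(\mathbf{s})}(\boldsymbol{\theta})=\prod_{l}\mathscr{P}_{jl}^{\boldsymbol{\theta}}(\gamma_{jl}(\mathbf{x}_{jl})=s_l)$. Fisher information matrix $\mathbf{J}(\boldsymbol{\theta})=\sum_j\sum_{\mathbf{s}}\frac{1}{q_j^{(\mathbf{s})}}\frac{\partial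 q_j^{(\mathbf{s})}}{\partial\boldsymbol{\theta}}\big[\frac{\partial q_j^{(\mathbf{s})}}{\partial\boldsymbol{\theta}}\big]^T$. Two distinct points are observationally equivalent if $\Pr(\mathbf{u}|\boldsymbol{\theta})=\Pr(\mathbf{u}|\boldsymbol{\theta}')$ for all $\mathbf{u}$; a point is identifiable if no other point is observationally equivalent to it; $\boldsymbol{\Theta}$ is identifiable if every point is. *)

(* Defs.v *)
From HB Require Import structures.
From mathcomp Require Import all_boot all_order all_algebra.
From mathcomp Require Import all_classical all_reals all_analysis.
Set Implicit Arguments. Unset Strict Implicit. Unset Printing Implicit Defensive.
Import Order.TTheory GRing.Theory Num.Theory numFieldNormedType.Exports.
Local Open Scope classical_set_scope.
Local Open Scope ring_scope.

Section QuantizedSystem.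
Variables (R : realType) (D N : nat) (L : 'I_N -> nat)
  (Rr : forall j : 'I_N, 'I_(L j) -> nat).
Arguments Rr : clear implicits.

(* Output of the superquantizer of sensor j: s = (s_1,...,s_{L_j}),
   s_l a quantization level of the l-th subquantizer (levels indexed from 0). *)
Definition sigspace (j : 'I_N) : finType := {dffun forall l : 'I_(L j), 'I_(Rr j l)}.

Definition fusedspace : finType := {dffun forall j : 'I_N, sigspace j}.

Variable d : forall (j : 'I_N) (l : 'I_(L j)), measure_display.
Arguments d : clear implicits.
Variable T : forall (j : 'I_N) (l : 'I_(L j)), measurableType (d j l).
Arguments T : clear implicits.
Variable P : forall (j : 'I_N) (l : 'I_(L j)), 'rV[R]_D -> probability (T j l) R.
Arguments P : clear implicits.
Variable I : forall (j : 'I_N) (l : 'I_(L j)), 'I_(Rr j l) -> set (T j l).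
Arguments I : clear implicits.

(* P_{jl}^theta(gamma_{jl}(x_{jl}) = r) = P_{jl}^theta(x_{jl} \in I_{jl}^{(r)}) *)
Definition qsub (j : 'I_N) (l : 'I_(L j)) (r : 'I_(Rr j l)) (th : 'rV[R]_D) : R :=
  fine (P j l th (I j l r)).

(* q_j^{(s)}(theta), under independence of the subvectors *)
Definition qj (j : 'I_N) (s : sigspace j) (th : 'rV[R]_D) : R :=
  \prod_(l < L j) qsub (s l) th.

(* Pr(u | theta), under independence across sensors *)
Definition Pru (u : fusedspace) (th : 'rV[R]_D) : R :=
  \prod_(j < N) qj (u j) th.

End QuantizedSystem.

Definition grad (R : realType) (D : nat) (f : 'rV[R]_D -> R) (th : 'rV[R]_D) : 'rV[R]_D :=
  \row_(i < D) 'D_(delta_mx 0 i) f th.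

Definition fisher_info (R : realType) (D N : nat) (S : 'I_N -> finType)
  (q : forall j : 'I_N, S j -> 'rV[R]_D -> R) (th : 'rV[R]_D) : 'M[R]_D :=
  \sum_(j < N) \sum_(s : S j) ((q j s th)^-1 *: ((grad (q j s) th)^T *m grad (q j s) th)).

Definition obs_equiv (R : realType) (D : nat) (U : Type) (Pr : U -> 'rV[R]_D -> R)
  (th th' : 'rV[R]_D) : Prop :=
  th <> th' /\ forall u, Pr u th = Pr u th'.

Definition identifiable_point (R : realType) (D : nat) (U : Type) (Pr : U -> 'rV[R]_D -> R)
  (Theta : set 'rV[R]_D) (th : 'rV[R]_D) : Prop :=
  ~ (exists th', Theta th' /\ obs_equiv Pr th th').

Definition identifiable (R : realType) (D : nat) (U : Type) (Pr : U -> 'rV[R]_D -> R)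
  (Theta : set 'rV[R]_D) : Prop :=
  forall th, Theta th -> identifiable_point Pr Theta th.

Definition lambda_indep (N : nat) (L : 'I_N -> nat) (Rr : forall j : 'I_N, 'I_(L j) -> nat) : int :=
  (\sum_(j < N) \sum_(l < L j) (Rr j l)%:Z - \sum_(j < N) (L j)%:Z)%R.

(* Main.v *)
(** The marginals P(gamma_jl = r), with one level omitted for each (j, l), form a family of
lambda_Indep functions of theta that determines every q_j.  For (i), the gradients of the q_j lie
in the span of the gradients of this family, so the Fisher information has rank at most
lambda_Indep < D.  For (ii), the family is a continuous map from an open subset of R^D to
R^lambda_Indep, and such a map is never injective; deleting finitely many points from the open set
does not affect this, hence infinitely many points are nonidentifiable.

The non-injectivity is derived from Kuhn's cubical form of Sperner's lemma.  Put a fine grid on a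
small cube and give a grid point z a colour i < D that avoids all the residues floor(M g_x(z)) mod D;
it exists since there are fewer than D coordinates x.  Along neighbours of the same colour i no
floor(M g_x) crosses a number congruent to i mod D, so it stays in one block of length D.  Hence a
completely labelled Kuhn simplex yields two grid points on opposite faces of the cube with close
images, contradicting injectivity by compactness. *)
Require Import Defs.
From HB Require Import structures.
From mathcomp Require Import all_boot all_order all_fingroup all_algebra.
From mathcomp Require Import all_classical all_reals all_analysis.
From mathcomp Require Import zify lra.
Import Order.TTheory GRing.Theory Num.Theory numFieldNormedType.Exports.
Set Implicit Arguments. Unset Strict Implicit. Unset Printing Implicit Defensive.
Local Open Scope ring_scope.

(** * Kuhn's cubical Sperner lemma *)

(* The determinant is 1 exactly when c maps {0, ..., n-1} onto itself. *)
Definition rainbow n (c : nat -> nat) : 'F_2 := \det (\matrix_(k < n, t < n) ((c k == t)%:R : 'F_2)).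

Lemma oppF2 (x : 'F_2) : - x = x.
Proof. by apply: val_inj; case: x => [[|[|]]]. Qed.

Lemma addFF2 (x : 'F_2) : x + x = 0.
Proof. by rewrite -{1}(oppF2 x) addNr. Qed.

Lemma eq_rainbow n c c' : (forall k, (k < n)%N -> c k = c' k) -> rainbow n c = rainbow n c'.
Proof. by move=> cc'; congr (\det _); apply/matrixP => i j; rewrite !mxE cc'. Qed.

Lemma rainbow_missing n c t : (t < n)%N -> (forall k, (k < n)%N -> c k <> t) -> rainbow n c = 0.
Proof.
move=> tn ct; rewrite /rainbow (expand_det_col _ (Ordinal tn)) big1 // => i _.
by rewrite mxE /=; case: eqP => [/ct|_]; rewrite ?mul0r//; case.
Qed.

(* Adding all columns to the last one makes it constant; then expand along it. *)
Lemma rainbow_facets n c : (forall k, (k <= n)%N -> (c k <= n)%N) ->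
  rainbow n.+1 c = \sum_(k < n.+1) rainbow n (fun a => c (bump k a)).
Proof.
move=> cn.
pose M := \matrix_(k < n.+1, t < n.+1) ((c k == t)%:R : 'F_2).
pose E := \matrix_(i < n.+1, t < n.+1) (((i == t) || (t == ord_max))%:R : 'F_2).
have detE : \det E = 1.
  rewrite -det_tr det_trig; last first.
    apply/is_trig_mxP => i j ij; rewrite !mxE.
    have -> : (j == i) = false by apply/negbTE; rewrite neq_ltn ij orbT.
    by rewrite -[i == ord_max]val_eqE /= ltn_eqF // (leq_trans ij) // -ltnS.
  by rewrite big1 // => i _; rewrite !mxE eqxx.
have -> : rainbow n.+1 c = \det (M *m E) by rewrite det_mulmx detE mulr1.
rewrite (expand_det_col _ ord_max); apply: eq_bigr => k _.
have ME i t : (M *m E) i t = ((c i == t) || (t == ord_max))%:R.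
  have ci : (c i < n.+1)%N by rewrite ltnS cn // -ltnS.
  rewrite mxE (bigD1 (Ordinal ci)) //= !mxE /= eqxx mul1r big1 ?addr0 // => j jc.
  by rewrite !mxE; case: eqP => [e|_]; rewrite ?mul0r //; case/eqP: jc; apply/val_inj.
rewrite ME eqxx orbT mul1r /cofactor.
have -> : (-1) ^+ (k + @ord_max n) = 1 :> 'F_2 by rewrite oppF2 expr1n.
rewrite mul1r; congr (\det _); apply/matrixP => a b; rewrite mxE [LHS]mxE ME mxE.
have bn : bump n b = b by rewrite /bump leqNgt ltn_ord.
by rewrite -[_ == ord_max]val_eqE /= bn [b == n :> nat]ltn_eqF ?orbF.
Qed.

(** Points are functions on all of [nat], zero from [D] on, so that one labelling serves every
    dimension in the induction on [D]. *)
Definition grid_point D (w : 'I_D -> nat) : nat -> nat :=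
  fun i => if insub i is Some j then w j else 0%N.

(* The k-th vertex of the simplex with base point w whose direction i is the (s i)-th step. *)
Definition kuhn_vertex D (w : 'I_D -> nat) (s : 'S_D) (k : nat) : nat -> nat :=
  grid_point (fun i => (w i + (s i < k))%N).

Lemma grid_pointE D (w : 'I_D -> nat) (i : 'I_D) : grid_point w i = w i.
Proof. by rewrite /grid_point valK. Qed.

Lemma grid_point_out D (w : 'I_D -> nat) i : (D <= i)%N -> grid_point w i = 0%N.
Proof. by move=> Di; rewrite /grid_point insubF // ltnNge Di. Qed.

Lemma eq_grid_point D (w w' : 'I_D -> nat) : w =1 w' -> grid_point w = grid_point w'.
Proof. by move=> /funext ->. Qed.

(** The bound is 0 for [i >= D]: the grid of dimension [D] is the face [z D = 0] of the next one. *)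
Definition in_grid D m (z : nat -> nat) := forall i, (z i <= (i < D) * m)%N.

Lemma grid_point_in D m (w : 'I_D -> nat) : (forall i, w i <= m)%N -> in_grid D m (grid_point w).
Proof.
move=> wm i; case: ltnP => iD; last by rewrite grid_point_out.
by rewrite mul1n (grid_pointE w (Ordinal iD)).
Qed.

(** Multiplication by [t] matches even permutations with odd ones, and equal terms cancel in
    ['F_2]. *)
Lemma sum_transp_inv D (t : 'S_D) (F : 'S_D -> 'F_2) :
  odd_perm t -> (forall s, F (s * t)%g = F s) -> \sum_s F s = 0.
Proof.
move=> ot Ft; rewrite (bigID (@odd_perm _)) /=.
rewrite (reindex_inj (mulIg t)) /= (eq_big (fun s : 'S_D => ~~ odd_perm s) F) ?addFF2 //.
by move=> s; rewrite odd_permM ot addbT.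
Qed.

Section Kuhn.
Variables (n : nat).
Local Notation m := n.+1.

Definition coords D (v : {ffun 'I_D -> 'I_m}) (i : 'I_D) : nat := v i.

(** Parity of the number of completely labelled simplices in Kuhn's triangulation of the cube of
    side [m]; [v] ranges over its unit cells. *)
Definition kuhn_sum D (l : (nat -> nat) -> nat) : 'F_2 :=
  \sum_(v : {ffun 'I_D -> 'I_m}) \sum_(s : 'S_D) rainbow D.+1 (fun k => l (kuhn_vertex (coords v) s k)).

(** The cubical counterpart of Sperner's boundary condition. Each positive label is banned from one
    near face, label 0 from every far face. *)
Definition kuhn_labelling D (l : (nat -> nat) -> nat) :=
  [/\ forall z, in_grid D m z -> (l z <= D)%N,
      forall z i, in_grid D m z -> l z = i.+1 -> (0 < z i)%N &
      forall z i, in_grid D m z -> (i < D)%N -> z i = m -> l z <> 0%N].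

(** On the face [z D = 0] the label [D.+1] is already banned. *)
Lemma kuhn_labelling_face D l : kuhn_labelling D.+1 l -> kuhn_labelling D l.
Proof.
move=> [l1 l2 l3]; have sub z : in_grid D m z -> in_grid D.+1 m z.
  move=> zD i; apply: leq_trans (zD i) _; rewrite leq_mul2r; apply/orP; right.
  by case: ltnP => // iD; rewrite (ltn_trans iD).
split=> [z zD|z i zD|z i zD iD]; last 2 first.
- exact: l2 (sub _ zD).
- exact: l3 (sub _ zD) (ltn_trans iD _).
have := l1 _ (sub _ zD); rewrite leq_eqVlt => /orP[/eqP/(l2 _ _ (sub _ zD))|//].
by have := zD D; rewrite ltnn mul0n; case: (z D).
Qed.

Lemma kuhn_vertex_in D (v : {ffun 'I_D -> 'I_m}) s k : in_grid D m (kuhn_vertex (coords v) s k).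
Proof.
by apply: grid_point_in => i; rewrite (leq_trans (leq_add (leqnn _) (leq_b1 _))) // addn1 ltn_ord.
Qed.

(* Interior facets are shared by the two simplices that differ by a transposition. *)
Lemma kuhn_interior_facets D l (v : 'I_D -> nat) (k : 'I_D.+1) : (0 < k < D)%N ->
  \sum_(s : 'S_D) rainbow D (fun a => l (kuhn_vertex v s (bump k a))) = 0.
Proof.
case/andP=> k0 kD; have k1D : (k.-1 < D)%N by rewrite (leq_ltn_trans (leq_pred _)).
pose x := Ordinal k1D; pose y := Ordinal kD.
have xy : x != y by rewrite -val_eqE /= neq_ltn prednK ?leqnn.
apply: (sum_transp_inv (t := tperm x y)) => [|s]; first by rewrite odd_tperm.
apply: eq_rainbow => a aD; congr l; apply: eq_grid_point => i; congr addn.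
rewrite permM; congr nat_of_bool; have := neq_bump k a.
case: tpermP => [->|->|//] /=; move: (bump k a) => b kb.
  by rewrite prednK // [RHS]leq_eqVlt (negbTE kb).
by rewrite prednK // [LHS]leq_eqVlt (negbTE kb).
Qed.

Definition succ_perm D : 'S_D.+1 := perm (@ordS_inj D.+1).

(** Gluing across cell walls: the facet opposite the first vertex is the facet opposite the last
    vertex of a simplex in the next cell. The cyclic shift turns the last step of [s] into the
    first. *)
Lemma kuhn_vertex_succ D (w : 'I_D.+1 -> nat) (s : 'S_D.+1) a : (a <= D)%N ->
  kuhn_vertex w (s * succ_perm D)%g a.+1 =
  kuhn_vertex (fun i => w i + (s i == ord_max))%N s a.
Proof.
move=> aD; apply: eq_grid_point => i; rewrite permM permE -addnA; congr addn.
move: (s i) => x; rewrite -val_eqE /=; have := ltn_ord x.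
rewrite ltnS leq_eqVlt => /predU1P[->|xD]; first by rewrite modnn eqxx /= ltnNge aD.
by rewrite modn_small // ltnS (ltn_eqF xD).
Qed.

(* Telescoping along the coordinate i: only the two extreme layers survive. *)
Lemma sum_layers D (i : 'I_D) (H : ('I_D -> nat) -> 'F_2) :
  \sum_(v : {ffun 'I_D -> 'I_m}) H (fun j => coords v j + (j == i))%N +
  \sum_(v : {ffun 'I_D -> 'I_m}) H (coords v) =
  \sum_(v : {ffun 'I_D -> 'I_m} | v i == ord_max)
    (H (fun j => coords v j + (j == i))%N + H (fun j => if j == i then 0%N else coords v j)).
Proof.
(* Below the top layer the cyclic successor adds 1, and the terms cancel in pairs; on the top layer
   it wraps around to 0. *)
pose sh (v : {ffun 'I_D -> 'I_m}) := [ffun j => if j == i then ordS (v j) else v j].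
have sh_inj : injective sh.
  move=> v w /ffunP vw; apply/ffunP => j; have := vw j; rewrite !ffunE.
  by case: eqP => // _ /ordS_inj.
rewrite [X in _ + X](reindex_inj sh_inj) /= -big_split /= (bigID (fun v : {ffun _} => v i == ord_max)) /=.
rewrite [X in _ + X]big1 ?addr0 => [|v vi]; last first.
  rewrite [X in _ + H X](_ : _ = fun j => (coords v j + (j == i))%N) ?addFF2 //.
  apply/funext => j; rewrite /coords ffunE; case: eqP => [->|]; last by rewrite addn0.
  rewrite /= modn_small ?addn1 // ltnS ltn_neqAle -ltnS ltn_ord andbT.
  exact: vi.
apply: eq_bigr => v /eqP vi; congr (_ + H _).
by apply/funext => j; rewrite /coords ffunE; case: eqP => // ->; rewrite vi /= modnn.
Qed.

Lemma image_lift_perm D :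
  [set s : 'S_D.+1 | s ord_max == ord_max] = (lift_perm ord_max ord_max) @: [set: 'S_D].
Proof.
apply/setP => s; rewrite inE; apply/eqP/imsetP => [sx|[t _ ->]]; last by rewrite lift_perm_id.
pose g k := odflt k (unlift ord_max (s (lift ord_max k))).
have gE k : lift ord_max (g k) = s (lift ord_max k).
  rewrite /g; have : ord_max != s (lift ord_max k).
    by rewrite -{1}sx (inj_eq perm_inj) neq_lift.
  by case/unlift_some => j -> ->.
have ginj : injective g.
  by move=> j k /(congr1 (lift ord_max)); rewrite !gE => /perm_inj/lift_inj.
exists (perm ginj) => //; apply/permP => k.
case: (unliftP ord_max k) => [j|] ->; last by rewrite lift_perm_id.
by rewrite lift_perm_lift permE gE.
Qed.

(** [sum_layers] indexes both extreme layers, even the one at 0, by cells whose coordinate is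
    [ord_max]; hence the padding value. *)
Definition extend_max D (v : {ffun 'I_D -> 'I_m}) : {ffun 'I_D.+1 -> 'I_m} :=
  [ffun i => if unlift ord_max i is Some j then v j else ord_max].

Lemma image_extend_max D :
  [set v : {ffun 'I_D.+1 -> 'I_m} | v ord_max == ord_max] = @extend_max D @: [set: {ffun 'I_D -> 'I_m}].
Proof.
apply/setP => v; rewrite inE; apply/eqP/imsetP => [vx|[w _ ->]]; last by rewrite ffunE unlift_none.
exists [ffun j => v (lift ord_max j)] => //; apply/ffunP => k; rewrite ffunE.
by case: unliftP => [j|] ->; rewrite ?ffunE.
Qed.

Lemma extend_max_inj D : injective (@extend_max D).
Proof. by move=> v w /ffunP vw; apply/ffunP => j; have := vw (lift ord_max j); rewrite !ffunE liftK. Qed.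

(** Count the facets carrying all labels from 0 to [D]. Those inside a cell cancel, as do walls
    between neighbouring cells, which leaves the boundary of the cube. A far face lacks label 0 and
    a near face [z i = 0] with [i < D] lacks label [i.+1], so only the face [z D = 0]
    contributes. *)
Lemma kuhn_sum_rec D l : kuhn_labelling D.+1 l -> kuhn_sum D.+1 l = kuhn_sum D l.
Proof.
move=> [l1 l2 l3].
pose H (s : 'S_D.+1) w := rainbow D.+1 (fun a => l (kuhn_vertex w s a)).
(* The direction of the last step, normal to the facet opposite the last vertex. *)
pose e (s : 'S_D.+1) := (s^-1)%g ord_max.
have se (s : 'S_D.+1) : s (e s) = ord_max by rewrite permKV.
have -> : kuhn_sum D.+1 l = \sum_(s : 'S_D.+1)
    (\sum_(v : {ffun 'I_D.+1 -> 'I_m}) H s (fun j => coords v j + (j == e s))%N +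
     \sum_(v : {ffun 'I_D.+1 -> 'I_m}) H s (coords v)).
  rewrite big_split /= [X in _ = X + _]exchange_big /= [X in _ = _ + X]exchange_big /= -big_split /=.
  apply: eq_bigr => v _.
  rewrite (eq_bigr _ (fun s _ => rainbow_facets (fun k _ => l1 _ (kuhn_vertex_in v s k)))) /=.
  rewrite exchange_big /= big_ord_recl big_ord_recr /= addrCA.
  rewrite big1 ?add0r => [|k _]; last first.
    by rewrite (@kuhn_interior_facets D.+1 l (coords v) (lift ord0 (widen_ord (leqnSn D) k))) //= /bump /= add1n ltnS.
  congr (_ + _).
    rewrite (reindex_inj (mulIg (succ_perm D))) /=; apply: eq_bigr => s _.
    apply: eq_rainbow => a aD; rewrite /bump /= add1n kuhn_vertex_succ //; congr (l (kuhn_vertex _ _ _)).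
    by apply/funext => j; rewrite -[in RHS](inj_eq (@perm_inj _ s)) se.
  apply: eq_bigr => s _; apply: eq_rainbow => a aD.
  by rewrite /bump /= add1n leqNgt aD.
under eq_bigr => s _ do rewrite sum_layers big_split /=.
have Htop (s : 'S_D.+1) (v : {ffun 'I_D.+1 -> 'I_m}) : v (e s) = ord_max -> H s (fun j => coords v j + (j == e s))%N = 0.
  move=> vi; apply: (rainbow_missing (t := 0)) => // a aD.
  have seD : (s (e s) < a)%N = false by rewrite se /= leqNgt aD.
  apply: (l3 _ (e s)) => //; last by rewrite /kuhn_vertex grid_pointE seD /coords vi eqxx addn0 addn1.
  apply: grid_point_in => j; case: eqP => [->|_]; first by rewrite seD addn0 addn1 ltn_ord.
  by rewrite addn0 (leq_trans (leq_add (leqnn _) (leq_b1 _))) // addn1 ltn_ord.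
have Hbot (s : 'S_D.+1) (v : {ffun 'I_D.+1 -> 'I_m}) : e s != ord_max -> H s (fun j => if j == e s then 0%N else coords v j) = 0.
  move=> sm; have sm' : ((e s).+1 < D.+1)%N.
    by rewrite ltnS ltn_neqAle -ltnS ltn_ord andbT; exact: sm.
  apply: (rainbow_missing sm') => a aD /l2.
  rewrite /kuhn_vertex grid_pointE eqxx se /= [(D < a)%N]leqNgt aD => H0.
  suff /H0 : in_grid D.+1 m (kuhn_vertex (fun j => if j == e s then 0%N else coords v j) s a) by [].
  apply: grid_point_in => j; case: eqP => _; first by rewrite add0n; case: (_ < _)%N.
  by rewrite (leq_trans (leq_add (leqnn _) (leq_b1 _))) // addn1 ltn_ord.
rewrite big_split /= [X in X + _]big1 ?add0r => [|s _]; last first.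
  by apply: big1 => v /eqP; exact: Htop.
rewrite (bigID (fun s : 'S_D.+1 => s ord_max == ord_max)) /= [X in _ + X]big1 ?addr0 => [|s sx]; last first.
  by apply: big1 => v _; apply: Hbot; apply: contra sx => /eqP es; rewrite -{1}es se.
rewrite -big_set image_lift_perm big_imset /=; last first.
  move=> s t _ _ /permP st; apply/permP => k; have := st (lift ord_max k).
  by rewrite !lift_perm_lift => /lift_inj.
rewrite /kuhn_sum exchange_big /= big_set; apply: eq_bigr => s _.
have -> : e (lift_perm ord_max ord_max s) = ord_max.
  by apply: (@perm_inj _ (lift_perm ord_max ord_max s)); rewrite se lift_perm_id.
rewrite -big_set image_extend_max big_imset /=; last by move=> v w _ _; exact: extend_max_inj.
rewrite big_set; apply: eq_bigr => v _; apply: eq_rainbow => a aD; congr l.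
(* Coordinate [D] stays 0: its step is the last one, which no vertex [a <= D] has taken. *)
apply/funext => i; case: (ltnP i D) => iD; last first.
  rewrite [RHS]grid_point_out //; move: iD; rewrite leq_eqVlt => /predU1P[<-|iD]; last first.
    by rewrite /kuhn_vertex grid_point_out.
  rewrite /kuhn_vertex (grid_pointE _ (@ord_max D)) eqxx lift_perm_id /=.
  by rewrite leqNgt aD.
have ie : i = lift ord_max (Ordinal iD) by rewrite lift_max.
rewrite /kuhn_vertex {1}ie grid_pointE (grid_pointE _ (Ordinal iD)) eq_sym (negbTE (neq_lift _ _)).
by rewrite lift_perm_lift lift_max /coords ffunE liftK.
Qed.

Lemma kuhn_sum1 D l : kuhn_labelling D l -> kuhn_sum D l = 1.
Proof.
elim: D => [|D IH] Kl; last by rewrite kuhn_sum_rec // IH //; exact: kuhn_labelling_face.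
have [l1 _ _] := Kl.
have r1 (v : {ffun 'I_0 -> 'I_m}) (s : 'S_0) : rainbow 1 (fun k => l (kuhn_vertex (coords v) s k)) = 1.
  by rewrite /rainbow det_mx11 mxE; have := l1 _ (kuhn_vertex_in v s 0); rewrite leqn0 => ->.
rewrite /kuhn_sum; under eq_bigr => v _ do under eq_bigr => s _ do rewrite r1.
by rewrite !sumr_const card_Sn card_ffun !card_ord.
Qed.

(** An odd sum has a nonzero term, and a simplex missing a label contributes 0. Its base vertex
    serves as [w]. *)
Lemma kuhn_lemma D l : kuhn_labelling D l ->
  exists w : nat -> nat, forall t, (t <= D)%N ->
    exists z, [/\ in_grid D m z, l z = t & forall i, (w i <= z i <= (w i).+1)%N].
Proof.
move=> Kl.
have : exists v : {ffun 'I_D -> 'I_m}, exists s : 'S_D,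
    rainbow D.+1 (fun k => l (kuhn_vertex (coords v) s k)) != 0.
  apply: contrapT => /forallNP nex; have := kuhn_sum1 Kl; rewrite /kuhn_sum big1 // => v _.
  apply: big1 => s _; apply/eqP/negPn/negP => H; apply: (nex v); by exists s.
move=> [v [s vs]]; exists (grid_point (coords v)) => t tD.
apply: contrapT => /forallNP nex; move/eqP: vs; apply.
apply: (@rainbow_missing _ _ t) => // k _ lk; apply: (nex (kuhn_vertex (coords v) s k)).
split=> // [|i]; first exact: kuhn_vertex_in.
case: (ltnP i D) => iD; last by rewrite /kuhn_vertex !grid_point_out.
rewrite /kuhn_vertex !(grid_pointE _ (Ordinal iD)) leq_addr /= -[X in (_ <= X)%N]addn1 leq_add2l.
exact: leq_b1.
Qed.
End Kuhn.

(** * Colourings of the grid *)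

(** Cut the integers into blocks of length [D] starting at the numbers congruent to [c]. Without
    these starting points, numbers from different blocks are at least 2 apart. *)
Lemma divz_adjacent (D : nat) (a b c : int) : (0 < D)%N -> (0 <= c < D%:Z)%R ->
  (`|a - b| <= 1)%R -> (a %% D)%Z != c -> (b %% D)%Z != c ->
  ((a - c) %/ D)%Z = ((b - c) %/ D)%Z.
Proof.
move=> D0 cD ab; have [x0 xD] := (modz_ge0 (a - c) (d := D), ltz_pmod (a - c) (d := D)).
have [y0 yD] := (modz_ge0 (b - c) (d := D), ltz_pmod (b - c) (d := D)).
have nz e : (e %% D)%Z != c -> ((e - c) %% D)%Z != 0.
  apply: contra => /eqP e0; rewrite -[e](subrK c) -modzDml e0 add0r modz_small //.
move=> /nz a0 /nz b0; have ea := divz_eq (a - c) D; have eb := divz_eq (b - c) D.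
move: ((a - c) %/ D)%Z ((a - c) %% D)%Z ((b - c) %/ D)%Z ((b - c) %% D)%Z x0 xD y0 yD a0 b0 ea eb.
move=> p x q y x0 xD y0 yD a0 b0 ea eb.
have {}x0 := x0 ltac:(lia); have {}y0 := y0 ltac:(lia).
have {}xD := xD ltac:(lia); have {}yD := yD ltac:(lia).
nia.
Qed.

Lemma divz_same (D : nat) (a b c : int) : (0 < D)%N ->
  ((a - c) %/ D)%Z = ((b - c) %/ D)%Z -> (`|a - b| <= D%:Z)%R.
Proof.
move=> D0 ab; have ea := divz_eq (a - c) D; have eb := divz_eq (b - c) D.
have [x0 xD] := (modz_ge0 (a - c) (d := D), ltz_pmod (a - c) (d := D)).
have [y0 yD] := (modz_ge0 (b - c) (d := D), ltz_pmod (b - c) (d := D)).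
have {}x0 := x0 ltac:(lia); have {}y0 := y0 ltac:(lia).
have {}xD := xD ltac:(lia); have {}yD := yD ltac:(lia).
move: ea eb; rewrite ab => ea eb; lia.
Qed.

Lemma free_residue (D : nat) (X : finType) (f : X -> int) : (#|X| < D)%N ->
  exists i : 'I_D, forall x, (f x %% D)%Z != i%:Z.
Proof.
move=> XD; have D0 : (0 < D)%N by apply: leq_ltn_trans XD.
apply: contrapT => nex.
have h (i : 'I_D) : exists x, (f x %% D)%Z = i%:Z.
  apply: contrapT => ni; apply: nex; exists i => x; apply/eqP => e; by apply: ni; exists x.
have [g gE] := choice h.
suff : (D <= #|X|)%N by rewrite leqNgt XD.
rewrite -[X in (X <= _)%N]card_ord; apply: (@leq_card _ _ g) => i j gij.
by apply/val_inj; have := gE i; rewrite gij gE => -[].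
Qed.

Definition adjacent (z z' : nat -> nat) := forall i, (z i <= (z' i).+1)%N /\ (z' i <= (z i).+1)%N.

(** Call a point low if its colour [i] and its bricks agree with those of a grid point on [z i = 0].
    A low point on [z i = n] yields the required pair. If there is none, Kuhn's lemma still gives a
    low point that lies on [z i = n] or has a non-low neighbour of its colour; but lowness passes
    between neighbours of one colour. *)
Lemma grid_far_close (D n : nat) (X : finType) (F : (nat -> nat) -> X -> int) :
  (#|X| < D)%N ->
  (forall z z' x, in_grid D n z -> in_grid D n z' -> adjacent z z' -> `|F z x - F z' x| <= 1) ->
  exists z z' i, [/\ in_grid D n z, in_grid D n z', (i < D)%N, z i = 0%N & z' i = n] /\
    forall x, `|F z x - F z' x| <= D%:Z.
Proof.
move=> XD Fadj; have D0 : (0 < D)%N by apply: leq_ltn_trans XD.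
have [c cE] := choice (fun z => free_residue (F z) XD).
apply: contrapT => nex.
pose brick z x := ((F z x - (c z)%:Z) %/ D)%Z.
pose low z := exists z', [/\ in_grid D n z', c z' = c z, brick z' =1 brick z & z' (c z) = 0%N].
have low_top z : in_grid D n z -> low z -> z (c z) <> n.
  move=> zn [z' [z'n cz bz z0]] zc; apply: nex; exists z', z, (c z); split=> // x.
  by apply: (@divz_same _ _ _ (c z)) => //; have := bz x; rewrite /brick cz.
have low_adj z z' : in_grid D n z -> in_grid D n z' -> adjacent z z' -> c z = c z' ->
    low z -> low z'.
  move=> zn z'n zz' cc [y [yn cy yb y0]]; exists y; split; rewrite -?cc // => x.
  rewrite yb /brick -cc; apply: divz_adjacent; rewrite ?Fadj //; last by rewrite cc.
  by rewrite /= ltz_nat ltn_ord.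
pose top (z : nat -> nat) := [pick i : 'I_D | z i == n.+1].
(* The grid is extended by the layers z i = n.+1, labelled i.+1; inside, label 0 marks the points
   whose block also meets the face of coordinate 0 in the direction of their colour. *)
pose l z := if top z is Some i then i.+1 else if `[<low z>] then 0%N else (c z).+1.
have notop z : in_grid D n.+1 z -> top z = None -> in_grid D n z.
  rewrite /top; case: pickP => // zt zn _ i; have := zn i; case: ltnP => // iD.
  by rewrite !mul1n leq_eqVlt ltnS; have /= -> := zt (Ordinal iD).
have [|w wl] := @kuhn_lemma n D l.
  split=> [z zn|z i zn|z i zn iD zi]; rewrite /l.
  - by case: (top z) => [i|]; [exact: ltn_ord | case: asboolP].
  - case E: (top z) => [j|].
      by move: E; rewrite /top; case: pickP => // k /eqP zk [<-] [<-]; rewrite zk.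
    case: asboolP => // nlow [<-]; rewrite lt0n; apply/eqP => z0; apply: nlow.
    by exists z; split=> //; exact: notop.
  - rewrite /top; case: pickP => [//|/(_ (Ordinal iD))].
    by rewrite /= zi eqxx.
have [z [zn]] := wl 0%N isT; rewrite /l; case E: (top z) => [//|].
case: asboolP => // zlow _ wz.
(* The vertex [y] labelled [(c z).+1] is either in the added layer, which forces [z (c z) = n], or a
   non-low point with the colour of [z]. *)
have [y [yn]] := wl (c z).+1 (ltn_ord _); rewrite /l => ly wy.
have zz := notop _ zn E; have zt := low_top _ zz zlow.
move: ly; case E': (top y) => [j|].
  move=> [jc]; move: E'; rewrite /top; case: pickP => // k /eqP yk [kj].
  move: yk; rewrite kj jc => yk; apply: zt.
  have := zz (c z); have := wz (c z); have := wy (c z); rewrite yk ltn_ord mul1n; lia.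
case: asboolP => // ylow [cc]; apply: ylow; apply: low_adj zlow => //.
- exact: notop.
- by move=> i; have := wz i; have := wy i; lia.
- exact/val_inj.
Qed.

Local Open Scope classical_set_scope.

(** * Continuous maps to lower dimension are not injective *)

(** Applied twice below with the roles of [F] and [H] exchanged. Near a point with [H p < eta] the
    claim is vacuous; elsewhere [F p / 2] is a local bound. *)
Lemma compact_pos_lower_bound (R : realType) (T : topologicalType) (K : set T) (F H : T -> R) (eta : R) :
  compact K -> (forall p, K p -> {for p, continuous F}) -> (forall p, K p -> {for p, continuous H}) ->
  (forall p, K p -> eta <= H p -> 0 < F p) ->
  exists2 delta, 0 < delta & forall p, K p -> eta <= H p -> delta <= F p.
Proof.
move=> /compact_near_coveringP cK cF cH HF.
have : \forall delta \near 0^'+, forall p, K p -> eta <= H p -> delta <= F p.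
  apply: cK => p Kp; have [Hp|Hp] := ltP (H p) eta.
    have Hn : \forall p' \near p, H p' < eta by exact: (cH p Kp _ (lt_nbhsl Hp)).
    near=> p' d => Hp'; have : H p' < eta by near: p'.
    by rewrite ltNge Hp'.
  have Fp := HF p Kp Hp.
  have F2 : F p / 2 < F p by lra.
  have Fn : \forall p' \near p, F p / 2 < F p' by exact: (cF p Kp _ (lt_nbhsr F2)).
  near=> p' d => _ /=; apply: (@le_trans _ _ (F p / 2)); last by apply/ltW; near: p'.
  by near: d; apply: nbhs_right_le; lra.
move=> small; near (0 : R)^'+ => d.
exists d; first by near: d; exact: nbhs_right_gt.
by near: d.
Unshelve. all: by end_near. Qed.

Lemma row_dist_lt (R : realType) D (x y : 'rV[R]_D) e : 0 < e ->
  (forall i, `|x 0 i - y 0 i| < e) -> `|x - y| < e.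
Proof.
move=> e0 xy; have -> : `|x - y| = mx_norm (x - y) by [].
have [->//|/mx_norm_neq0[[i j] ->]] := eqVneq (mx_norm (x - y)) 0.
by rewrite !mxE /= ord1.
Qed.

Lemma coord_dist_le (R : realType) D (x y : 'rV[R]_D) i : `|x 0 i - y 0 i| <= `|x - y|.
Proof.
have -> : `|x - y| = mx_norm (x - y) by [].
rewrite mx_normrE; have := le_bigmax 0 (fun ij => `|(x - y) ij.1 ij.2|) (0, i).
by rewrite !mxE.
Qed.

Lemma floor_dist (R : realType) (a b : R) : `|a - b| < 1 -> `|Num.floor a - Num.floor b| <= 1.
Proof.
have [[[a1 a2] b1] b2] := (floor_le a, floorD1_gt a, floor_le b, floorD1_gt b).
rewrite ltr_norml => /andP[h1 h2].
have h3 : (Num.floor a < Num.floor b + 2)%R by rewrite -(ltr_int R) rmorphD /=; rewrite rmorphD /= in b2; lra.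
have h4 : (Num.floor b < Num.floor a + 2)%R by rewrite -(ltr_int R) rmorphD /=; rewrite rmorphD /= in a2; lra.
lia.
Qed.

Lemma dist_floor (R : realType) (a b : R) (k : nat) : `|Num.floor a - Num.floor b| <= k%:Z -> `|a - b| <= k.+1%:R.
Proof.
have [[[a1 a2] b1] b2] := (floor_le a, floorD1_gt a, floor_le b, floorD1_gt b).
rewrite rmorphD /= in a2; rewrite rmorphD /= in b2.
rewrite ler_norml => /andP[]; rewrite -!(ler_int R) rmorphN rmorphB /= => h1 h2.
rewrite ler_norml -natr1; apply/andP; split; lra.
Qed.

Lemma cvg_bigsum (R : realType) (T I : Type) (G : set_system T) (FG : Filter G)
    (r : seq I) (P : pred I) (f : I -> T -> R) (a : I -> R) :
  (forall i, P i -> f i t @[t --> G] --> a i) ->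
  (\sum_(i <- r | P i) f i t) @[t --> G] --> \sum_(i <- r | P i) a i.
Proof.
move=> fa; elim: r => [|i r IH].
  by under eq_fun do rewrite big_nil; rewrite big_nil; exact: cvg_cst.
rewrite big_cons; under eq_fun do rewrite big_cons.
by case: ifP => // Pi; apply: cvgD => //; exact: fa.
Qed.

Lemma no_continuous_injection (R : realType) (D : nat) (X : finType) (g : X -> 'rV[R]_D -> R)
    (U : set 'rV[R]_D) :
  (#|X| < D)%N -> open U -> U !=set0 -> (forall x y, U y -> {for y, continuous (g x)}) ->
  exists y y', [/\ U y, U y', y <> y' & forall x, g x y = g x y'].
Proof.
move=> XD oU [a Ua] cg; apply: contrapT => nex.
have [e e0 eU] : exists2 e : R, 0 < e & ball a e `<=` U.
  by have := open_nbhs_nbhs (conj oU Ua); rewrite -nbhs_ballE => -[e /= e0 eU]; exists e.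
(* Half the radius keeps the closed cube [K] inside the open ball. *)
pose r := e / 2; have r0 : 0 < r by rewrite /r; lra.
pose K := [set y : 'rV[R]_D | forall i, `[a 0 i, a 0 i + r] (y 0 i)].
have cK : compact K by apply: (@rV_compact R D (fun i => `[a 0 i, a 0 i + r])) => i; exact: segment_compact.
have KU y : K y -> U y.
  move=> Ky; apply: eU; rewrite mx_norm_ball /ball_ /=; apply: row_dist_lt => // i.
  by have := Ky i; rewrite /= in_itv /= ltr_norml /r => /andP[]; lra.
pose F (p : 'rV[R]_D * 'rV[R]_D) : R := \sum_(x : X) `|g x p.1 - g x p.2|.
pose H (p : 'rV[R]_D * 'rV[R]_D) := `|p.1 - p.2|.
have cKK := compact_setX cK cK.
have cF p : (K `*` K) p -> {for p, continuous F}.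
  move=> [K1 K2]; apply: cvg_bigsum => x _.
  apply: cvg_norm; apply: cvgB.
    by apply: (@cvg_comp _ _ _ fst (g x) _ (nbhs p.1)); [exact: cvg_fst | exact/cg/KU].
  by apply: (@cvg_comp _ _ _ snd (g x) _ (nbhs p.2)); [exact: cvg_snd | exact/cg/KU].
have cH p : (K `*` K) p -> {for p, continuous H}.
  by move=> _; apply: cvg_norm; apply: cvgB; [exact: cvg_fst | exact: cvg_snd].
have F0 p : (K `*` K) p -> r <= H p -> 0 < F p.
  case: p => y y' [/= K1 K2]; rewrite /H /= => ryy'.
  have Fge x : true -> 0 <= `|g x y - g x y'| by [].
  rewrite lt0r sumr_ge0 // andbT; apply/eqP => /(psumr_eq0P Fge) gyy.
  apply: nex; exists y, y'; split; [exact: KU|exact: KU| |].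
    by move=> yy'; move: ryy'; rewrite yy' subrr normr0; lra.
  by move=> x; apply/eqP; rewrite -subr_eq0 -normr_eq0 gyy.
(* Points of [K] at distance at least [r] have images at least [d1] apart. *)
have [d1 d10 d1P] := compact_pos_lower_bound cKK cF cH F0.
(* In the end fewer than [D] coordinates differ by at most [D.+1] over [M] each; their sum has to
   stay below [d1]. *)
pose M := (Num.truncn ((D * D.+1)%:R / d1)).+1.
have M0 : 0 < M%:R :> R by rewrite ltr0n.
have Md1 : (D * D.+1)%:R / M%:R < d1.
  by rewrite ltr_pdivrMr // mulrC -ltr_pdivrMr // truncnS_gt.
have H0 p : (K `*` K) p -> M%:R^-1 <= F p -> 0 < H p.
  case: p => y y' _ HF; rewrite normr_gt0 /= subr_eq0; apply/eqP => yy'.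
  have : 0 < M%:R^-1 :> R by rewrite invr_gt0.
  suff F_0 : F (y, y') = 0 by rewrite F_0 in HF; lra.
  by rewrite /F /= yy' big1 // => x _; rewrite subrr normr0.
(* Uniform continuity: points of [K] closer than [d2] have images less than 1 over [M] apart. *)
have [d2 d20 d2P] := compact_pos_lower_bound cKK cH cF H0.
(* With mesh [r / n] below [d2], the values scaled by [M] differ by less than 1 at adjacent grid
   points. *)
pose n := (Num.truncn (r / d2)).+1.
have n0 : 0 < n%:R :> R by rewrite ltr0n.
have nd2 : r / n%:R < d2.
  by rewrite ltr_pdivrMr // mulrC -ltr_pdivrMr // truncnS_gt.
pose pt (z : nat -> nat) : 'rV[R]_D := \row_i (a 0 i + r * ((z i)%:R / n%:R)).
have ptK z : in_grid D n z -> K (pt z).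
  move=> zn i; rewrite /= in_itv /= mxE lerDl lerD2l.
  have q0 : 0 <= (z i)%:R / n%:R :> R by rewrite divr_ge0.
  have q1 : (z i)%:R / n%:R <= 1 :> R.
    by rewrite ler_pdivrMr // mul1r ler_nat; have := zn i; rewrite ltn_ord mul1n.
  by rewrite (mulr_ge0 (ltW r0) q0) (ler_piMr (ltW r0) q1).
have entry_le x p : `|g x p.1 - g x p.2| <= F p.
  by rewrite /F (bigD1 x) //= lerDl sumr_ge0.
pose Fl z x := Num.floor (M%:R * g x (pt z)).
have Fl_adj z z' x : in_grid D n z -> in_grid D n z' -> adjacent z z' -> `|Fl z x - Fl z' x| <= 1.
  move=> zn z'n zz'; apply: floor_dist; rewrite -mulrBr normrM gtr0_norm // -ltr_pdivlMl // mulr1.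
  apply: le_lt_trans (entry_le x (pt z, pt z')) _; rewrite ltNge; apply/negP.
  move=> /(d2P (pt z, pt z') (conj (ptK _ zn) (ptK _ z'n))).
  apply/negP; rewrite -ltNge; apply: row_dist_lt => // i.
  rewrite !mxE opprD addrACA subrr add0r -mulrBr normrM gtr0_norm // -mulrBl.
  rewrite normrM [`|n%:R^-1|]gtr0_norm ?invr_gt0 // mulrCA.
  apply: le_lt_trans nd2; apply: (ler_piMl (ltW (divr_gt0 r0 n0))).
  have [] := zz' i; rewrite -!(ler_nat R) -!natr1 ler_norml => *.
  by apply/andP; split; lra.
have [z [z' [i [[zn z'n iD zi z'i] close]]]] := grid_far_close XD Fl_adj.
have := d1P (pt z, pt z') (conj (ptK _ zn) (ptK _ z'n)).
have rH : r <= H (pt z, pt z').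
  apply: le_trans (coord_dist_le (pt z) (pt z') (Ordinal iD)).
  rewrite !mxE /= zi z'i mul0r mulr0 addr0 divff ?gt_eqF // mulr1.
  by rewrite opprD addrA subrr add0r normrN gtr0_norm.
move=> /(_ rH); apply/negP; rewrite -ltNge; apply: le_lt_trans Md1.
rewrite ler_pdivlMr // /F big_distrl /=.
apply: (@le_trans _ _ (\sum_(x : X) D.+1%:R)).
  apply: ler_sum => x _; have := dist_floor (close x).
  by rewrite -mulrBr normrM gtr0_norm // mulrC.
by rewrite sumr_const -mulrnA ler_nat [leqRHS]mulnC leq_mul2l ltnW ?orbT.
Qed.

(** * Marginals, gradients and the free parameters *)

Lemma prod_sum_dffun (R : comNzRingType) (I : finType) (T_ : I -> finType) (F : forall i, T_ i -> R) :
  \prod_i \sum_(t : T_ i) F i t = \sum_(s : {dffun forall i, T_ i}) \prod_i F i (s i).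
Proof.
rewrite [RHS](reindex _ (onW_bij _ (dffun_of_fprod_bij T_))) /=.
under [RHS]eq_bigr => t _ do under eq_bigr => i _ do rewrite ffunE.
transitivity (\sum_(t : fprod T_) \prod_(i in I) [ffun u => F i u] (t i)); last first.
  by apply: eq_bigr => t _; apply: eq_bigr => i _; rewrite ffunE.
rewrite (@big_fprod R 0 1 *%R +%R I T_ (fun i => [ffun u => F i u])).
rewrite (eq_bigr _ (fun i _ => big_tag (fun i t => F i t) i)) bigA_distr_big_dep.
apply: eq_bigr => g _; apply: eq_bigr => i _.
by rewrite /untag; case: eqP => // e; rewrite ffunE.
Qed.

Lemma marginal_sum (R : comNzRingType) (I : finType) (T_ : I -> finType) (F : forall i, T_ i -> R)
    (i0 : I) (t0 : T_ i0) :
  (forall i, \sum_t F i t = 1) ->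
  \sum_(s : {dffun forall i, T_ i} | s i0 == t0) \prod_i F i (s i) = F i0 t0.
Proof.
(* The indicator of [s i0 = t0], inserted as a factor, replaces the constraint on [s]; the factors
   other than [i0] then sum to 1. Tagged values are compared because [t] and [t0] have different
   types. *)
move=> F1; pose Q i (t : T_ i) := (i == i0) ==> (Tagged T_ t == Tagged T_ t0).
have := prod_sum_dffun (fun i t => F i t * (Q i t)%:R).
rewrite (bigD1 i0) //= [X in _ * X]big1 ?mulr1 => [|i ii0]; last first.
  by rewrite -[RHS](F1 i); apply: eq_bigr => t _; rewrite /Q (negbTE ii0) mulr1.
rewrite (bigD1 t0) //= /Q !eqxx mulr1 big1 ?addr0 => [->|t tt0]; last first.
  by rewrite eq_Tagged /= (negbTE tt0) mulr0.
rewrite big_mkcond; apply: eq_bigr => s _; rewrite big_split /=; case: ifPn => [/eqP st|st].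
  rewrite [X in _ * X]big1 ?mulr1 // => i _; case: eqP => //= ii0.
  by rewrite ii0 st eqxx.
by rewrite [X in _ * X](bigD1 i0) //= eqxx eq_Tagged /= (negbTE st) mul0r mulr0.
Qed.

Lemma sum_probability_cells d (T : measurableType d) (R : realType) (P : probability T R)
    (n : nat) (I : 'I_n -> set T) :
  (forall r, measurable (I r)) -> (forall r r', r <> r' -> I r `&` I r' = set0) ->
  \bigcup_(r in [set: 'I_n]) I r = [set: T] -> \sum_(r < n) fine (P (I r)) = 1.
Proof.
move=> mI dI cI; have := probability_setT P; rewrite -cI.
rewrite measure_fin_bigcup //; last 2 first.
- exact: finite_finset.
- by move=> i j _ _ [x Ix]; apply: contrapT => /dI e; rewrite e in Ix.
have -> : [set: 'I_n] = [set` index_enum 'I_n].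
  by apply/seteqP; split => // i _ /=; rewrite mem_index_enum.
rewrite -fsbig_seq ?index_enum_uniq // => PI.
rewrite sum_fine => [|i _]; last exact: fin_num_measure.
by rewrite PI.
Qed.

Section GradientSpan.
Variables (R : realType) (D k : nat) (B : 'M[R]_(k, D)) (th : 'rV[R]_D).

(** Differentiability is bundled in because the sum and product rules for [grad] need it. *)
Definition grad_in_span (f : 'rV[R]_D -> R) := differentiable f th /\ (grad f th <= B)%MS.

Lemma grad_in_span_cst c : grad_in_span (fun=> c).
Proof.
split; first exact: differentiable_cst.
rewrite (_ : grad _ _ = 0) ?sub0mx //.
by apply/rowP => i; rewrite !mxE derive_cst.
Qed.

Lemma grad_in_spanM f g : grad_in_span f -> grad_in_span g -> grad_in_span (fun t => f t * g t).
Proof.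
move=> [df fB] [dg gB]; split; first exact: differentiableM.
rewrite (_ : grad _ _ = f th *: grad g th + g th *: grad f th).
  by rewrite addmx_sub ?scalemx_sub.
by apply/rowP => i; rewrite !mxE; apply: deriveM; exact: diff_derivable.
Qed.

Lemma grad_in_spanD f g : grad_in_span f -> grad_in_span g -> grad_in_span (fun t => f t + g t).
Proof.
move=> [df fB] [dg gB]; split; first exact: differentiableD.
rewrite (_ : grad _ _ = grad f th + grad g th); first by rewrite addmx_sub.
by apply/rowP => i; rewrite !mxE; apply: deriveD; exact: diff_derivable.
Qed.

Lemma grad_in_span_prod (I : Type) (r : seq I) (f : I -> 'rV[R]_D -> R) :
  (forall i, grad_in_span (f i)) -> grad_in_span (fun t => \prod_(i <- r) f i t).
Proof.
move=> fB; elim: r => [|i r IH].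
  by under eq_fun do rewrite big_nil; exact: grad_in_span_cst.
by under eq_fun do rewrite big_cons; exact: grad_in_spanM.
Qed.

Lemma grad_in_span_sum (I : Type) (r : seq I) (P : pred I) (f : I -> 'rV[R]_D -> R) :
  (forall i, P i -> grad_in_span (f i)) -> grad_in_span (fun t => \sum_(i <- r | P i) f i t).
Proof.
move=> fB; elim: r => [|i r IH].
  by under eq_fun do rewrite big_nil; exact: grad_in_span_cst.
under eq_fun do rewrite big_cons.
case Pi: (P i); last exact: IH.
by apply: grad_in_spanD => //; exact: fB.
Qed.

End GradientSpan.

Lemma differentiable_bigsum (R : realType) D (th : 'rV[R]_D) (I : Type) (r : seq I) (P : pred I)
    (f : I -> 'rV[R]_D -> R) :
  (forall i, P i -> differentiable (f i) th) -> differentiable (fun t => \sum_(i <- r | P i) f i t) th.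
Proof.
(* For the identity matrix the span condition is void. *)
move=> df; apply: (proj1 (grad_in_span_sum (B := 1%:M) r _)) => i Pi.
by split; [exact: df | exact: submx1].
Qed.

(** Every row of [g^T *m g] is a multiple of [g], whatever the weight, even where [q] vanishes and
    its inverse is 0 by convention. *)
Lemma fisher_info_span (R : realType) (D N k : nat) (S : 'I_N -> finType)
    (q : forall j, S j -> 'rV[R]_D -> R) (th : 'rV[R]_D) (B : 'M[R]_(k, D)) :
  (forall j s, (grad (q j s) th <= B)%MS) -> (fisher_info q th <= B)%MS.
Proof.
move=> qB; apply: summx_sub => j _; apply: summx_sub => s _.
by rewrite scalemx_sub // (submx_trans (submxMl _ _)).
Qed.

Lemma infinite_open_row (R : realType) D (U : set 'rV[R]_D) :
  (0 < D)%N -> open U -> U !=set0 -> infinite_set U.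
Proof.
move=> D0 oU [a Ua] /finite_seqP[s Us].
have [e e0 eU] : exists2 e : R, 0 < e & ball a e `<=` U.
  by have := open_nbhs_nbhs (conj oU Ua); rewrite -nbhs_ballE => -[e /= e0 eU]; exists e.
(* Denominators start at 2 to keep the points strictly inside the ball. *)
pose u (k : nat) : 'rV[R]_D := a + const_mx (e / k.+2%:R).
have uinj : injective u.
  move=> i j /addrI/rowP/(_ (Ordinal D0)); rewrite !mxE => /(mulfI (lt0r_neq0 e0))/invr_inj/eqP.
  by rewrite eqr_nat => /eqP[].
have uU k : U (u k).
  apply: eU; rewrite mx_norm_ball /ball_ /=; apply: row_dist_lt => // i.
  rewrite !mxE opprD addrA subrr add0r normrN gtr0_norm ?divr_gt0 //.
  by rewrite ltr_pdivrMr // ltr_pMr // ltr1n.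
have := @uniq_leq_size _ [seq u k | k <- iota 0 (size s).+1] s.
rewrite map_inj_uniq // iota_uniq size_map size_iota ltnn => /(_ isT).
suff sub : {subset [seq u k | k <- iota 0 (size s).+1] <= s} by move=> /(_ sub).
by move=> _ /mapP[k _ ->]; have := uU k; rewrite Us.
Qed.

Lemma last_level_eq (R : realType) n (f : 'I_n -> R) (r : 'I_n) : \sum_r f r = 1 -> r = n.-1 :> nat ->
  f r = 1 - \sum_(k < n.-1) f (widen_ord (leq_pred n) k).
Proof.
case: n f r => [f []//|n] f r; rewrite big_ord_recr /= => <- rn.
have -> : r = ord_max by exact/val_inj.
apply/eqP; rewrite eq_sym subr_eq addrC; apply/eqP; congr (_ + _).
by apply: eq_bigr => k _; congr f; exact/val_inj.
Qed.

Section FreeParameters.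
Variables (R : realType) (D N : nat) (L : 'I_N -> nat) (Rr : forall j : 'I_N, 'I_(L j) -> nat).
Variables (d : forall (j : 'I_N) (l : 'I_(L j)), measure_display).
Variables (T : forall (j : 'I_N) (l : 'I_(L j)), measurableType (d l)).
Variables (P : forall (j : 'I_N) (l : 'I_(L j)), 'rV[R]_D -> probability (T l) R).
Variables (I : forall (j : 'I_N) (l : 'I_(L j)), 'I_(Rr l) -> set (T l)).

(* The levels of all subquantizers, the last level of each being omitted. *)
Definition free_level : finType := {j : 'I_N & {l : 'I_(L j) & 'I_(Rr l).-1}}.

Definition qfree (x : free_level) : 'rV[R]_D -> R :=
  qsub P I (widen_ord (leq_pred _) (tagged (tagged x))).

Variable q1 : forall (j : 'I_N) (l : 'I_(L j)) th, \sum_(r < Rr l) qsub P I r th = 1.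

(** A subquantizer without levels would have total probability 0, so [Rr l] is positive and its
    predecessor is a true subtraction. *)
Lemma card_free_level : #|free_level|%:Z = lambda_indep Rr.
Proof.
have Rr0 (j : 'I_N) (l : 'I_(L j)) : (0 < Rr l)%N.
  rewrite lt0n; apply/eqP => Rl0; have := q1 l 0; rewrite big1; last first.
    by move=> r; have := ltn_ord r; rewrite {2}Rl0.
  by move=> /eqP; rewrite eq_sym oner_eq0.
rewrite card_tagged sumnE big_map big_enum /= /lambda_indep -sumrB.
rewrite (big_morph Posz PoszD (erefl 0%:Z)); apply: eq_bigr => j _.
rewrite card_tagged sumnE big_map big_enum /= (big_morph Posz PoszD (erefl 0%:Z)).
have -> : (L j)%:Z = \sum_(l < L j) 1%:Z by rewrite sumr_const card_ord natz.
rewrite -sumrB; apply: eq_bigr => l _; rewrite card_ord.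
by have := Rr0 j l; lia.
Qed.

Lemma qsub_free (j : 'I_N) (l : 'I_(L j)) (r : 'I_(Rr l)) :
  (exists x, qsub P I r = qfree x) \/
  qsub P I r = fun th => 1 - \sum_(k < (Rr l).-1)
    qfree (Tagged (fun j : 'I_N => {l : 'I_(L j) & 'I_(Rr l).-1}) (Tagged (fun l => 'I_(Rr l).-1) k)) th.
Proof.
have [rl|rl] := ltnP r (Rr l).-1.
  left; exists (Tagged (fun j : 'I_N => {l : 'I_(L j) & 'I_(Rr l).-1})
    (Tagged (fun l => 'I_(Rr l).-1) (Ordinal rl))).
  by rewrite /qfree /=; congr qsub; exact/val_inj.
right; apply/funext => th; apply: (last_level_eq (f := fun r => qsub P I r th)); first exact: q1.
by apply/eqP; rewrite eqn_leq rl andbT; have := ltn_ord r; lia.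
Qed.

(** The regularity hypotheses concern only the [qj]; this formula transfers them to the
    marginals. *)
Lemma qsub_marginal (j : 'I_N) (l : 'I_(L j)) (r : 'I_(Rr l)) :
  qsub P I r = fun th => \sum_(s : sigspace Rr j | s l == r) qj P I s th.
Proof.
apply/funext => th; symmetry.
exact: (marginal_sum (F := fun l r => qsub P I r th) r (fun l => q1 l th)).
Qed.

Lemma Pru_eq_free th th' : (forall x, qfree x th = qfree x th') -> forall u, Pru P I u th = Pru P I u th'.
Proof.
move=> qx u; apply: eq_bigr => j _; apply: eq_bigr => l _.
case: (qsub_free (u j l)) => [[x ->]|->]; first exact: qx.
by congr (_ - _); apply: eq_bigr.
Qed.

Lemma fisher_info_rank th :
  (forall j (s : sigspace Rr j), differentiable (qj P I s) th) ->
  (\rank (fisher_info (fun j (s : sigspace Rr j) => qj P I s) th) <= #|free_level|)%N.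
Proof.
move=> dq; pose B := \matrix_(k < #|free_level|) grad (qfree (enum_val k)) th.
have dqsub (j : 'I_N) (l : 'I_(L j)) (r : 'I_(Rr l)) : differentiable (qsub P I r) th.
  by rewrite qsub_marginal; exact: differentiable_bigsum.
have Bfree x : grad_in_span B th (qfree x).
  split; first exact: dqsub.
  by have := row_sub (enum_rank x) B; rewrite rowK enum_rankK.
apply: leq_trans (mxrankS (fisher_info_span _)) (rank_leq_row B) => j s.
suff [] : grad_in_span B th (qj P I s) by [].
apply: grad_in_span_prod => l; case: (qsub_free (s l)) => [[x ->]|->] //.
under eq_fun do rewrite -mulN1r.
apply: grad_in_spanD; first exact: grad_in_span_cst.
apply: grad_in_spanM; first exact: grad_in_span_cst.
by apply: grad_in_span_sum.
Qed.

(** A finite set [S] of nonidentifiable points is closed, so two points of [U] outside [S] share all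
    marginals. They are nonidentifiable too, a contradiction. *)
Lemma infinite_nonidentifiable (Theta U : set 'rV[R]_D) :
  (#|free_level| < D)%N ->
  (forall j (s : sigspace Rr j), {within Theta, continuous (qj P I s)}) ->
  open U -> U !=set0 -> U `<=` Theta ->
  infinite_set [set th | U th /\ ~ identifiable_point (Pru P I) Theta th].
Proof.
move=> XD cq oU U0 UT finS; set S := [set th | _] in finS.
have cfree x y : (U `\` S) y -> {for y, continuous (qfree x)}.
  move=> [Uy _]; rewrite /qfree qsub_marginal; apply: (@cvg_bigsum _ _ _ (nbhs y) _) => s _.
  have := continuous_subspaceW UT (cq _ s); rewrite continuous_open_subspace // => cs.
  by apply: cs; rewrite inE.
have oV : open (U `\` S).
  rewrite setDE; apply: openI => //; apply: closed_openC; apply: (iffLR accessible_finite_set_closed) => //.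
  exact/hausdorff_accessible/norm_hausdorff.
have V0 : (U `\` S) !=set0.
  apply: contrapT => nV; apply: (@infinite_open_row _ _ U) => //; first exact: leq_ltn_trans XD.
  apply: sub_finite_set finS => y Uy; apply: contrapT => nSy; by apply: nV; exists y.
have [y [y' [[Uy nSy] [Uy' _] yy' qyy']]] := no_continuous_injection XD oV V0 cfree.
apply: nSy; split=> // idy; apply: idy; exists y'; split; first exact: UT.
by split=> //; exact: Pru_eq_free.
Qed.
End FreeParameters.

Theorem theorem4 (R : realType) (D N : nat) (L : 'I_N -> nat)
  (Rr : forall j : 'I_N, 'I_(L j) -> nat)
  (d : forall (j : 'I_N) (l : 'I_(L j)), measure_display)
  (T : forall (j : 'I_N) (l : 'I_(L j)), measurableType (d j l))
  (P : forall (j : 'I_N) (l : 'I_(L j)), 'rV[R]_D -> probability (T j l) R)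
  (I : forall (j : 'I_N) (l : 'I_(L j)), 'I_(Rr j l) -> set (T j l))
  (Theta : set 'rV[R]_D)
  (I_meas : forall j l r, measurable (I j l r))
  (I_disj : forall j l (r r' : 'I_(Rr j l)), r <> r' -> I j l r `&` I j l r' = set0)
  (I_cover : forall j l, \bigcup_(r in [set: 'I_(Rr j l)]) I j l r = [set: T j l]) :
  ((* (i) *)
   Theta° !=set0 ->
   (forall j (s : sigspace Rr j) th, Theta th ->
      differentiable (qj P I s) th /\
      forall i : 'I_D, differentiable ('D_(delta_mx 0 i) (qj P I s)) th) ->
   lambda_indep Rr < D%:Z ->
   forall th, Theta th ->
     ~~ (fisher_info (fun j (s : sigspace Rr j) => qj P I s) th \in unitmx))
  /\
  ((* (ii) *)
   Theta° !=set0 ->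
   (forall j (s : sigspace Rr j), {within Theta, continuous (qj P I s)}) ->
   lambda_indep Rr < D%:Z ->
   ~ identifiable (Pru P I) Theta /\
   forall U : set 'rV[R]_D, open U -> U !=set0 -> U `<=` Theta ->
     infinite_set [set th | U th /\ ~ identifiable_point (Pru P I) Theta th]).
Proof.
have q1 j l th : \sum_(r < Rr j l) qsub P I r th = 1.
  exact: (sum_probability_cells (P j l th) (I_meas j l) (I_disj j l) (I_cover j l)).
have card_lt : lambda_indep Rr < D%:Z -> (#|free_level Rr| < D)%N.
  by rewrite -(card_free_level q1) ltz_nat.
split=> [_ dq lD th Tth|[a Ta] cq lD].
  apply/negP => /mxrank_unit rD; have := card_lt lD.
  rewrite ltnNge -[X in (X <= _)%N]rD (fisher_info_rank q1) // => j s.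
  by have [] := dq j s th Tth.
have infS := infinite_nonidentifiable q1 (card_lt lD) cq.
split=> [idT|U oU U0 UT]; last exact: infS.
(* The interior of [Theta] is an admissible open set; identifiability would leave it without
   nonidentifiable points. *)
have := infS _ (@open_interior _ Theta) (ex_intro _ a Ta) (@interior_subset _ Theta).
apply; rewrite (_ : [set th | _] = set0); first exact: finite_set0.
by apply/seteqP; split => // th [/interior_subset/idT].
Qed.
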